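(* Every chordal planar graph of toughness greater than $1$ is Hamilton-connected.
   Context: All graphs are finite and simple. The toughness of a graph $G$ is the minimum, taken over all separating sets $X$ of vertices of $G$ (sets such that $G-X$ is disconnected), of the ratio of $|X|$ to the number of components of $G-X$; the toughness of a complete graph is defined as infinite. A graph is Hamilton-connected if for every pair of its (distinct) vertices there is a Hamilton path between them. *)

(* Defs.v *)
From mathcomp Require Import all_boot all_order all_algebra.
From mathcomp Require Import all_classical all_reals all_analysis.
Import Order.TTheory GRing.Theory Num.Theory.
Import numFieldNormedType.Exports.

Set Implicit Arguments.
Unset Strict Implicit.
Unset Printing Implicit Defensive.

Local Open Scope classical_set_scope.
Local Open Scope ring_scope.

(* A finite simple graph is a symmetric irreflexive adjacency relation e on a
   finite type T; the definitions below are meant for such e. *)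

(* Adjacency in G - X, kept on the whole vertex type: the removed vertices
   become isolated and are discarded by counting only inside ~: X. *)
Definition del_rel (T : finType) (e : rel T) (X : {set T}) : rel T :=
  [rel x y | [&& x \notin X, y \notin X & e x y]].

Definition ncomp_del (T : finType) (e : rel T) (X : {set T}) : nat :=
  n_comp (del_rel e X) (mem (~: X)).

Definition separating (T : finType) (e : rel T) (X : {set T}) : bool :=
  (1 < ncomp_del e X)%N.

(* Complete graphs have no separating set, so their minimum is +oo. *)
Definition toughness (T : finType) (e : rel T) : \bar rat :=
  \big[Order.min/+oo%E]_(X : {set T} | separating e X)
    (#|X|%:R / (ncomp_del e X)%:R)%:E.

(* ucycle e c: c lists without repetition the vertices of a closed walk; it is
   a cycle of the graph as soon as its size is at least 3. A chord is an edge
   between two vertices of c that are not consecutive on c. *)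
Definition chordal (T : finType) (e : rel T) : Prop :=
  forall c : seq T, ucycle e c -> (3 < size c)%N ->
    exists x y : T,
      [/\ x \in c, y \in c, e x y, y != next c x & x != next c y].

Definition is_arc (R : realType) (a b : R * R) (A : set (R * R)) : Prop :=
  exists g : R -> R * R,
    [/\ {within `[0, 1], continuous g}, {in `[0, 1] &, injective g},
        g 0 = a, g 1 = b & A = g @` `[0, 1]].

(* The unoriented edge uv is the set [set u; v], drawn as the arc
   A [set u; v]; the values of A on other sets are irrelevant. *)
Definition planar_drawing (R : realType) (T : finType) (e : rel T)
    (p : T -> R * R) (A : {set T} -> set (R * R)) : Prop :=
  [/\ injective p,
      forall u v, e u v -> is_arc (p u) (p v) (A [set u; v]%SET),
      forall u v w, e u v -> A [set u; v]%SET (p w) -> w = u \/ w = v &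
      forall u v x y, e u v -> e x y -> [set u; v]%SET != [set x; y]%SET ->
        forall z, A [set u; v]%SET z -> A [set x; y]%SET z ->
          exists2 w : T, w \in ([set u; v] :&: [set x; y])%SET & z = p w].

Definition planar (R : realType) (T : finType) (e : rel T) : Prop :=
  exists (p : T -> R * R) (A : {set T} -> set (R * R)), planar_drawing e p A.

Definition hamilton_path (T : finType) (e : rel T) (u v : T) (s : seq T) :
    Prop :=
  [/\ path e u s, last u s = v, uniq (u :: s) & forall x, x \in u :: s].

Definition hamilton_connected (T : finType) (e : rel T) : Prop :=
  forall u v : T, u != v -> exists s : seq T, hamilton_path e u v s.

(* Main.v *)
Require Import Defs.
From mathcomp Require Import all_boot all_order all_algebra.
From mathcomp Require Import all_classical all_reals all_analysis.
From mathcomp Require Import zify lra.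
From Stdlib Require Import Btauto.
Import Order.TTheory GRing.Theory Num.Theory.
Import numFieldNormedType.Exports.

(** Of planarity only one consequence is needed: a planar graph contains no K5.
Of toughness greater than 1 only this: if a set X separates k >= 2 vertices
pairwise, then k < |X|, and it is used for cliques X of at most four vertices.

A planar graph contains no K5 for a parity reason. Suppose K5 is drawn with
vertices p 0, ..., p 4. Sample every arc finely and count modulo 2 how often
the vector from a sample of an arc to a point off the arc crosses the positive
horizontal axis. For two disjoint arcs the difference of a point of one and a
point of the other is a map from a square to the punctured plane, so the count
along the boundary of the square is even; cutting the square into cells too
small to wind around the origin proves this by a telescoping sum
([crossings_grid]). The boundary consists of four counts, of an endpoint of one
arc against the other arc, up to corrections that record in which half-plane
the differences of endpoints lie ([disjoint_arcs_parity]). Sum this relation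
over the 15 pairs of disjoint edges of K5: each count occurs twice, while the
corrections of the three pairs inside each of the five 4-subsets of the
vertices add up to 1 ([K5_parity]). Hence 0 = 5 modulo 2.

Let abc be a triangle. Call C a region of abc if C is connected, disjoint from
abc, and has no neighbours outside C and abc; C may be empty. In a chordal
graph a nonempty region contains a vertex x adjacent to a, b and c, and the
rest of C splits into regions of xbc, xac and xab: since there is no K5, each
component of C - x has no edge to one of a, b, c; by toughness this vertex is
unique, and no two components share it. If C and abc do not exhaust the graph,
then toughness applied to the clique abcx shows that one of the three
subregions is empty ([region_split]). This gives two inductive statements about
a region C of abc that leaves something outside.
- There is a path from a to b whose interior is exactly C ([link_region]): go
  through x, and put one of the at most two nonempty subregions on each side.
- For v in C there is a path from a to v that covers a, b, c and C and uses the
  edge bc ([traverses_region]).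

For a Hamilton path from u to v take a triangle u, b, c. Its complement
consists of at most two regions. If both are nonempty and v lies in one of
them, the second statement leads to v through the edge bc, and the first
replaces bc by a path through the other region ([spanning_two_sides]). The
remaining cases are explicit concatenations of such paths
([spanning_one_side]). *)

Set Implicit Arguments.
Unset Strict Implicit.
Unset Printing Implicit Defensive.

(** * Crossing parities of sampled curves *)

Section Crossings.
Variable R : realType.
Local Open Scope ring_scope.
Implicit Types (w v : R * R) (d : R).

(** The argument of [w] lies in the half-open interval from 0 to pi, so that
exactly one of [w] and [- w] is [upper] when [w] is nonzero. *)
Definition upper w := (0 < w.2) || ((w.2 == 0) && (0 < w.1)).

(** For nearby nonzero vectors this says that the short turn from [w] to [v]
passes through the positive horizontal axis; if the half-planes
differ, the first coordinates have the same sign. *)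
Definition crosses w v := (upper w != upper v) && (0 < w.1).

Definition closeby d w v := (`|w.1 - v.1| < d) && (`|w.2 - v.2| < d).

Definition far d w := (d <= `|w.1|) || (d <= `|w.2|).

Lemma upperN w : w != 0 -> upper (- w) = ~~ upper w.
Proof.
case: w => x y; rewrite /upper /= oppr_gt0 oppr_eq0 oppr_gt0 => xy0.
case: (ltrgt0P y) xy0 => [//|//|->]; case: (ltrgt0P x) => // ->.
by rewrite eqxx.
Qed.

Lemma far_neq0 d w : 0 < d -> far d w -> w != 0.
Proof.
move=> d0; apply: contraTneq => ->.
by rewrite /far /= normr0 orbb leNgt d0.
Qed.

(** The second coordinates have opposite signs and differ by less than [d], so
the first coordinate is the large one. *)
Lemma upper_neq_wide d w v : upper w != upper v -> closeby d w v -> far d w ->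
  d <= `|w.1|.
Proof.
move=> up /andP [_ wv] fw.
have w2 : `|w.2| < d.
  apply: le_lt_trans wv; move: up; rewrite /upper.
  case: (ltrgt0P w.2) => w2 /=; case: (ltrgt0P v.2) => v2 //= _;
    rewrite ?w2 ?v2 ?subr0 ?normr0 ?normr_ge0 //;
    by rewrite ler_normr; apply/orP; first [left; lra | right; lra].
by move: fw; rewrite /far (leNgt d `|w.2|) w2 orbF.
Qed.

Lemma wide_sign d w v : d <= `|w.1| -> closeby d w v -> (0 < v.1) = (0 < w.1).
Proof.
move=> w1 /andP [wv _]; have := lt_le_trans wv w1.
case: (ltrgt0P w.1) => [w10|w10|->]; last by rewrite ltNge normr_ge0.
  by rewrite ltr_norml => /andP [? ?]; lra.
by rewrite ltr_norml => /andP [? ?]; lra.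
Qed.

(** Four vectors this close together do not surround the origin. If they are not
all in the same half-plane, their first coordinates have the same sign, and
[crosses] records the changes of half-plane if this sign is positive, and nothing
otherwise. *)
Lemma crosses_square d w0 w1 w2 w3 :
  pairwise (closeby d) [:: w0; w1; w2; w3] -> far d w0 ->
  crosses w0 w1 (+) crosses w2 w3 = crosses w0 w2 (+) crosses w1 w3.
Proof.
move=> /= /andP [/and4P [n1 n2 n3 _] _] f0; rewrite /crosses.
have side v : closeby d w0 v -> [|| upper w0 != upper w1, upper w0 != upper w2 |
    upper w0 != upper w3] -> (0 < v.1) = (0 < w0.1).
  by move=> nv /or3P [] up; apply: wide_sign nv; apply: upper_neq_wide up _ f0.
move: (side w1 n1) (side w2 n2).
case: (upper w0) (upper w1) (upper w2) (upper w3) => [] [] [] [] //=;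
  by move=> /(_ isT) E1 /(_ isT) E2; rewrite ?E1 ?E2; case: (0 < _).
Qed.

(** The turn from [- w] to [- v] passes through the positive axis when the turn
from [w] to [v] passes through the negative axis, and a change of half-plane
happens on exactly one of the two. *)
Lemma crossesN d w v : 0 < d -> closeby d w v -> far d w -> far d v ->
  crosses w v (+) crosses (- w) (- v) = upper w (+) upper v.
Proof.
move=> d0 nwv fw fv; rewrite /crosses /= oppr_gt0.
rewrite (upperN (far_neq0 d0 fw)) (upperN (far_neq0 d0 fv)).
case: (boolP (upper w == upper v)) => [/eqP ->|up]; first by rewrite !eqxx addbb.
have w0 : w.1 != 0.
  rewrite -normr_gt0; apply: lt_le_trans d0 _; exact: upper_neq_wide up nwv fw.
by move: up; case: (upper w) (upper v) => [] [] //= _; case: ltrgt0P w0.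
Qed.

Definition crossings (g : nat -> R * R) n :=
  \big[addb/false]_(i < n) crosses (g i) (g i.+1).

Lemma crossingsS g n : crossings g n.+1 = crossings g n (+) crosses (g n) (g n.+1).
Proof. exact: big_ord_recr. Qed.

Lemma crossingsN d g n : 0 < d ->
  (forall i, (i <= n)%N -> far d (g i)) ->
  (forall i, (i < n)%N -> closeby d (g i) (g i.+1)) ->
  crossings g n (+) crossings (fun i => - g i) n = upper (g 0) (+) upper (g n).
Proof.
move=> d0; elim: n => [|n IH] fg ng; first by rewrite /crossings !big_ord0 !addbb.
rewrite !crossingsS addbACA (crossesN d0 (ng n _) (fg n _) (fg n.+1 _)) //.
rewrite (IH (fun i ni => fg i (leqW ni)) (fun i ni => ng i (leqW ni))).
by rewrite -addbA addKb.
Qed.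

(** The sum of [crosses_square] over all cells; the inner edges cancel. *)
Lemma crossings_grid d (w : nat -> nat -> R * R) m n :
  (forall i j, (i < m)%N -> (j < n)%N ->
     pairwise (closeby d) [:: w i j; w i j.+1; w i.+1 j; w i.+1 j.+1]) ->
  (forall i j, (i < m)%N -> (j < n)%N -> far d (w i j)) ->
  crossings (w 0) n (+) crossings (w m) n =
  crossings (w^~ 0) m (+) crossings (w^~ n) m.
Proof.
move=> nw fw.
have strip i : (i < m)%N -> crossings (w i) n (+) crossings (w i.+1) n =
    crosses (w i 0) (w i.+1 0) (+) crosses (w i n) (w i.+1 n).
  move=> im; elim: n nw fw => [|n IH] nw fw.
    by rewrite /crossings !big_ord0 !addbb.
  rewrite !crossingsS addbACA (crosses_square (nw i n im (ltnSn n)) (fw i n im (ltnSn n))).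
  rewrite (IH (fun i j im jn => nw i j im (leqW jn)) (fun i j im jn => fw i j im (leqW jn))).
  by rewrite -addbA addKb.
elim: m strip {nw fw} => [|m IH] strip; first by rewrite /crossings !big_ord0 !addbb.
rewrite !(crossingsS (w^~ _)) addbACA -(IH (fun i im => strip i (leqW im))).
by rewrite -(strip m (ltnSn m)) -addbA addKb.
Qed.

(** On the two sides of the grid of differences [g i - h j] where [i] is
constant, an endpoint of [g] is counted against [h]. On the other two sides it is
the endpoint of [h] that is fixed, and the difference has to be reversed to get the
count of this endpoint against [g]; [crossingsN] gives the correction. *)
Lemma crossings_pair d (g h : nat -> R * R) n : 0 < d ->
  (forall i j, (i <= n)%N -> (j <= n)%N -> far d (g i - h j)) ->
  (forall i, (i < n)%N -> closeby (d / 2) (g i) (g i.+1)) ->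
  (forall i, (i < n)%N -> closeby (d / 2) (h i) (h i.+1)) ->
  crossings (fun j => g 0 - h j) n (+) crossings (fun j => g n - h j) n
    (+) crossings (fun i => h 0 - g i) n (+) crossings (fun i => h n - g i) n
  = upper (g 0 - h 0) (+) upper (g n - h 0) (+) upper (g 0 - h n) (+) upper (g n - h n).
Proof.
move=> d0 fgh ng nh.
have grid : crossings (fun j => g 0 - h j) n (+) crossings (fun j => g n - h j) n =
    crossings (fun i => g i - h 0) n (+) crossings (fun i => g i - h n) n.
  apply: (@crossings_grid d (fun i j => g i - h j)) => i j im jn; last first.
    by apply: fgh; apply: ltnW.
  move: (ng i im) (nh j jn); rewrite /closeby /= !ltr_norml.
  move=> /and3P [/andP [? ?] ? ?] /and3P [/andP [? ?] ? ?].
  by repeat (apply/andP; split) => //; lra.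
have turn j : (j <= n)%N -> crossings (fun i => g i - h j) n (+) crossings (fun i => h j - g i) n =
    upper (g 0 - h j) (+) upper (g n - h j).
  move=> jn; rewrite -(crossingsN d0 (g := fun i => g i - h j)).
  - by congr (_ (+) _); apply: eq_bigr => i _; rewrite !opprB.
  - by move=> i im; apply: fgh.
  - move=> i im; move: (ng i im); rewrite /closeby /= !ltr_norml => /and3P [/andP [? ?] ? ?].
    by repeat (apply/andP; split) => //; lra.
by rewrite grid -addbA addbACA !turn // addbA.
Qed.

End Crossings.

(** * Sampling disjoint arcs *)

Section Sampling.
Variable R : realType.
Local Open Scope classical_set_scope.
Local Open Scope ring_scope.
Implicit Types (f g : R -> R * R) (d : R).

Lemma ball_closeby d (w v : R * R) : ball w d v <-> closeby d w v.
Proof.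
split; first by case=> b1 b2; apply/andP; split; [exact: b1|exact: b2].
by case/andP=> b1 b2; split; [exact: b1|exact: b2].
Qed.

Lemma closeby_mid d (u w v : R * R) :
  closeby (d / 2) u w -> closeby (d / 2) u v -> closeby d w v.
Proof.
rewrite /closeby !ltr_norml => /andP [/andP [? ?] /andP [? ?]] /andP [/andP [? ?] /andP [? ?]].
by repeat (apply/andP; split); lra.
Qed.

(** Uniform continuity on the unit interval, from its compactness. *)
Lemma sample_closeby f d : {within `[0, 1], continuous f} -> 0 < d ->
  exists n0 : nat, forall n i, (n0 <= n)%N -> (i < n)%N ->
    closeby d (f (i%:R / n%:R)) (f (i.+1%:R / n%:R)).
Proof.
move=> /subspace_continuousP cf d0.
have cover : near_covering_within (`[0, 1] : set R).
  by apply/near_covering_withinP/compact_near_coveringP/segment_compact.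
pose P (n : nat) (t : R) := forall s : R,
  s \in `[0, 1] -> `|t - s| <= n.+1%:R^-1 -> closeby d (f t) (f s).
have [x Kx|n0 _ nP] := cover nat \oo P _.
  have : nbhs (f x) (ball (f x) (d / 2)) by apply: nbhsx_ballx; lra.
  move=> /(cf x Kx) [r /= r0 rP].
  have r2 : 0 < r / 2 by rewrite divr_gt0.
  near=> y n => /= Ky s Ks ys.
  have xy : `|x - y| < r / 2.
    by near: y; apply: (nbhsx_ballx x (r / 2)); lra.
  have nr : n.+1%:R^-1 < r / 2.
    by near: n; apply: (near_infty_natSinv_lt (PosNum r2)).
  have close (z : R) : `[0, 1]%classic z -> `|x - z| < r -> closeby (d / 2) (f x) (f z).
    by move=> Kz xz; apply/ball_closeby; apply: rP.
  have := ler_normD (x - y) (y - s); rewrite addrA subrK => tri.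
  have cy : closeby (d / 2) (f x) (f y) by apply: close => //; lra.
  have cs : closeby (d / 2) (f x) (f s).
    apply: close => //; apply: le_lt_trans tri _; rewrite (splitr r).
    by apply: ltrD => //; exact: le_lt_trans ys nr.
  exact: closeby_mid cy cs.
exists n0.+1 => -[//|n] i n0n i_n; apply: (nP n n0n) => /=.
- by rewrite in_itv /= divr_ge0 // ler_pdivrMr ?ltr0n // mul1r ler_nat ltnW.
- by rewrite in_itv /= divr_ge0 // ler_pdivrMr ?ltr0n // mul1r ler_nat.
- by rewrite -mulrBl -natr1 opprD addNKr mulN1r normrN ger0_norm.
Unshelve. all: by end_near. Qed.

(** The differences of points of the two images form a compact set that does
not contain 0, so it avoids a ball around 0. *)
Lemma sample_far f g : {within `[0, 1], continuous f} -> {within `[0, 1], continuous g} ->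
  (forall s t, s \in `[0, 1] -> t \in `[0, 1] -> f s <> g t) ->
  exists2 d, 0 < d & forall s t, s \in `[0, 1] -> t \in `[0, 1] -> far d (f s - g t).
Proof.
move=> cf cg fg.
have cpt (h : R -> R * R) : {within `[0, 1], continuous h} -> compact (h @` `[0, 1]).
  by move=> ch; apply: continuous_compact ch (@segment_compact _ _ _).
pose D : set (R * R) := (fun wv : (R * R) * (R * R) => wv.1 - wv.2) @`
  ((f @` `[0, 1]) `*` (g @` `[0, 1])).
have clD : closed D.
  apply: compact_closed; first exact: norm_hausdorff.
  apply: continuous_compact; last exact: compact_setX (cpt f cf) (cpt g cg).
  apply: continuous_subspaceT => wv.
  by apply: continuousB; [apply: cvg_fst | apply: cvg_snd].
have D0 : (~` D) 0.
  move=> [[w v] [/= [s Ks <-] [t Kt <-]] /eqP]; rewrite subr_eq0 => /eqP.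
  exact: fg.
have : nbhs (0 : R * R) (~` D) by apply: open_nbhs_nbhs; split=> //; apply: closed_openC.
move=> /nbhs_ballP [d /= d0 dP]; exists d => // s t Ks Kt.
apply: contrapT => /negP; rewrite /far negb_or -!ltNge => /andP [h1 h2].
apply: (dP (f s - g t)).
  by apply/ball_closeby/andP; rewrite !sub0r !normrN.
by exists (f s, g t) => //; split; [exists s | exists t].
Qed.

(** The bound on the sampling rate depends on the two arcs; a common rate for
finitely many pairs of arcs is obtained by taking the largest. *)
Lemma disjoint_arcs_parity f g :
  {within `[0, 1], continuous f} -> {within `[0, 1], continuous g} ->
  (forall s t, s \in `[0, 1] -> t \in `[0, 1] -> f s <> g t) ->
  exists n0 : nat, forall n, (n0 <= n)%N ->
    crossings (fun j => f 0 - g (j%:R / n%:R)) n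
      (+) crossings (fun j => f 1 - g (j%:R / n%:R)) n
      (+) crossings (fun i => g 0 - f (i%:R / n%:R)) n
      (+) crossings (fun i => g 1 - f (i%:R / n%:R)) n
    = upper (f 0 - g 0) (+) upper (f 1 - g 0) (+) upper (f 0 - g 1) (+) upper (f 1 - g 1).
Proof.
move=> cf cg fg; have [d d0 dP] := sample_far cf cg fg.
have d2 : 0 < d / 2 by rewrite divr_gt0.
have [nf fP] := sample_closeby cf d2; have [ng gP] := sample_closeby cg d2.
exists (maxn nf ng).+1 => -[//|n]; rewrite ltnS geq_max => /andP [fn gn].
have unit i : (i <= n.+1)%N -> i%:R / n.+1%:R \in `[(0 : R), 1].
  by move=> le_i; rewrite in_itv /= divr_ge0 // ler_pdivrMr ?ltr0n // mul1r ler_nat.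
have := @crossings_pair R d (fun i => f (i%:R / n.+1%:R)) (fun i => g (i%:R / n.+1%:R)) n.+1 d0.
rewrite /= !mul0r !divff ?pnatr_eq0 //; apply.
- by move=> i j i_n j_n; apply: dP; apply: unit.
- by move=> i i_n; apply: fP => //; apply: leqW.
- by move=> i i_n; apply: gP => //; apply: leqW.
Qed.

End Sampling.

(** * K5 is not planar *)

(** Here [c x i j] is the count of vertex [x] against the edge [ij], and [h i j]
is the half-plane of the vector from vertex [j] to vertex [i]. *)
Lemma K5_parity (h : nat -> nat -> bool) (c : nat -> nat -> nat -> bool) :
  (forall i j, i < j < 5 -> h j i = ~~ h i j) ->
  (forall i j k l, i < j < 5 -> k < l < 5 -> uniq [:: i; j; k; l] ->
    c i k l (+) c j k l (+) c k i j (+) c l i j =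
    h i k (+) h j k (+) h i l (+) h j l) -> False.
Proof.
move=> hN eqn.
(* The relations for the three pairs of disjoint edges on [i], [j], [k], [l]. *)
have four i j k l : i < j < k -> k < l < 5 ->
    (c i k l (+) c j k l (+) c k i j (+) c l i j) (+)
    (c i j l (+) c k j l (+) c j i k (+) c l i k) (+)
    (c i j k (+) c l j k (+) c j i l (+) c k i l).
  move=> ijk kl5; rewrite (eqn i j k l) ?(eqn i k j l) ?(eqn i l j k) /= ?inE; first last.
  1-9: clear -ijk kl5; lia.
  have [jk jl kl] : [/\ h k j = ~~ h j k, h l j = ~~ h j l & h l k = ~~ h k l].
    by split; apply: hN; clear -ijk kl5; lia.
  rewrite jk jl kl.
  by case: (h i j) (h i k) (h i l) (h j k) (h j l) (h k l) => [] [] [] [] [] [].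
(* Every count occurs in exactly two of the five relations. *)
move: (four 0 1 2 3 isT isT) (four 0 1 2 4 isT isT) (four 0 1 3 4 isT isT).
move: (four 0 2 3 4 isT isT) (four 1 2 3 4 isT isT) => F0 F1 F2 F3 F4.
have addbE a b : a (+) b = xorb a b by case: a b => [] [].
pose S a b d e f := a (+) b (+) d (+) e (+) f.
have := erefl (S true true true true true).
rewrite -{1}F0 -{1}F1 -{1}F2 -{1}F3 -{1}F4 /S !addbE => abs.
suff : false = true by []; rewrite -[RHS]abs; btauto.
Qed.

Section K5.
Variables (R : realType) (T : finType) (e : rel T).
Local Open Scope classical_set_scope.
Local Open Scope ring_scope.

Lemma planar_K5_free (s : seq T) :
  irreflexive e -> planar R e -> size s = 5 -> ~~ pairwise e s.
Proof.
move=> e_irr [p [A [p_inj arcs _ cross]]]; case: s => // v0 s.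
set vs := v0 :: s => size5; apply/negP => clique.
have uvs : uniq vs := pairwise_uniq e_irr clique.
pose v := nth v0 vs.
have adj i j : (i < j < 5)%N -> e (v i) (v j).
  case/andP=> ij j5; apply: (pairwiseP v0 clique) => //; rewrite inE size5 //.
  exact: ltn_trans j5.
have vE i j : (i < 5)%N -> (j < 5)%N -> (v i == v j) = (i == j).
  by move=> i5 j5; rewrite nth_uniq ?size5.
(* One parametrization per edge, from the smaller index to the larger: a drawing
   provides one for each direction, possibly unrelated. *)
have /choice [g gP] : forall ij : nat * nat, exists g : R -> R * R,
    (ij.1 < ij.2 < 5)%N ->
    [/\ {within `[0, 1], continuous g}, g 0 = p (v ij.1), g 1 = p (v ij.2) &
      forall t, t \in `[0, 1] -> A [set v ij.1; v ij.2]%SET (g t)].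
  move=> [i j]; case: (boolP (i < j < 5)%N) => [ij|]; last by exists (fun=> 0).
  have [g [cg _ g0 g1 gA]] := arcs _ _ (adj _ _ ij).
  by exists g => _; split=> // t t01; rewrite gA; exists t.
pose good ij kl := [&& (ij.1 < ij.2 < 5)%N, (kl.1 < kl.2 < 5)%N &
  uniq [:: ij.1; ij.2; kl.1; kl.2]].
pose c n x ij := crossings (fun t => p (v x) - g ij (t%:R / n%:R)) n.
pose h i j := upper (p (v i) - p (v j)).
have /choice [N0 N0P] : forall q : (nat * nat) * (nat * nat), exists n0,
    good q.1 q.2 -> forall n, (n0 <= n)%N ->
    c n q.1.1 q.2 (+) c n q.1.2 q.2 (+) c n q.2.1 q.1 (+) c n q.2.2 q.1 =
    h q.1.1 q.2.1 (+) h q.1.2 q.2.1 (+) h q.1.1 q.2.2 (+) h q.1.2 q.2.2.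
  move=> [ij kl]; case: (boolP (good ij kl)) => [/and3P [ij5 kl5 u]|_]; last by exists 0%N.
  have [cij ij0 ij1 ijA] := gP ij ij5; have [ckl kl0 kl1 klA] := gP kl kl5.
  have [|n0 n0P] := disjoint_arcs_parity cij ckl.
    move=> x y x01 y01 xy.
    have disj w : w \in [set v ij.1; v ij.2]%SET -> w \notin [set v kl.1; v kl.2]%SET.
      move: u ij5 kl5; rewrite /= !inE; clear -vE => u ij5 kl5.
      case/orP=> /eqP ->; rewrite negb_or !vE; clear -u ij5 kl5; lia.
    have [||w] := cross _ _ _ _ (adj _ _ ij5) (adj _ _ kl5) _ (g ij x) (ijA x x01).
    - by apply/eqP => E; have := disj (v ij.1); rewrite -E !inE eqxx => /(_ isT).
    - by rewrite xy; apply: klA.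
    - by rewrite inE => /andP [/disj /negbTE ->].
  by exists n0 => _ n /n0P; rewrite ij0 ij1 kl0 kl1.
pose N := \max_(q : ('I_5 * 'I_5) * ('I_5 * 'I_5))
  N0 ((val q.1.1, val q.1.2), (val q.2.1, val q.2.2)).
apply: (@K5_parity h (fun x i j => c N x (i, j))).
- move=> i j ij; rewrite /h -opprB upperN // subr_eq0 (inj_eq p_inj) vE; clear -ij; lia.
- move=> i j k l ij kl u.
  have [i5 j5 k5 l5] : [/\ i < 5, j < 5, k < 5 & l < 5]%N by clear -ij kl; split; lia.
  apply: (N0P ((i, j), (k, l))); first by rewrite /good /= ij kl.
  exact: (leq_bigmax ((Ordinal i5, Ordinal j5), (Ordinal k5, Ordinal l5))).
Qed.
End K5.

(** * Chordal graphs *)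

Import mathcomp.boot.fintype mathcomp.boot.finset.
Local Open Scope set_scope.
Local Open Scope nat_scope.

Section Graph.
Variables (T : finType) (e : rel T).
Hypothesis e_sym : symmetric e.
Hypothesis e_irr : irreflexive e.
Hypothesis e_chordal : chordal e.
Hypothesis e_tough : (1%:E < toughness e)%E.
Hypothesis K5_free : forall s : seq T, size s = 5 -> ~~ pairwise e s.

Lemma mem_cat_cons (x : T) s : x \in s -> exists s1 s2, s = s1 ++ x :: s2.
Proof. by case/path.splitPr=> s1 s2; exists s1, s2. Qed.

Lemma next_cat (s t : seq T) u w :
  uniq (s ++ u :: w :: t) -> next (s ++ u :: w :: t) u = w.
Proof.
move=> us; rewrite -(next_rot (size s) us) rot_size_cat /=.
by rewrite eqxx.
Qed.

Lemma next_wrap (s : seq T) u w :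
  uniq (u :: rcons s w) -> next (u :: rcons s w) w = u.
Proof.
move=> us; rewrite -(next_rot (size (u :: s)) us) -rcons_cons -cats1.
by rewrite rot_size_cat /= eqxx.
Qed.

(** The positions of the ends of a chord on the cycle: the vertices strictly
between them, on either side, are not empty. *)
Lemma chord_split (c : seq T) : ucycle e c -> 3 < size c ->
  exists s1 s2 s3 u w, [/\ c = s1 ++ u :: s2 ++ w :: s3, e u w,
    0 < size s2 & 0 < size s1 + size s3].
Proof.
move=> cc c3; have uc := ucycle_uniq cc.
have [u [w [uc' wc euw wNu uNw]]] := e_chordal cc c3.
have ordered u' w' s t : c = s ++ u' :: t -> w' \in t -> e u' w' ->
    w' != next c u' -> u' != next c w' ->
    exists s1 s2 s3 u w, [/\ c = s1 ++ u :: s2 ++ w :: s3, e u w,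
      0 < size s2 & 0 < size s1 + size s3].
  move=> defc /mem_cat_cons [s2 [s3 deft]] eu wN uN.
  rewrite {}deft in defc; exists s, s2, s3, u', w'; split=> //; rewrite lt0n; apply/eqP.
    move/size0nil => s20; rewrite {}s20 /= in defc.
    by rewrite defc next_cat ?eqxx // -defc in wN.
  move/eqP; rewrite addn_eq0 !size_eq0 => /andP [/eqP s0 /eqP s30].
  rewrite {}s0 {}s30 /= cats1 in defc.
  by rewrite defc next_wrap ?eqxx // -defc in uN.
have [s [t defc]] := mem_cat_cons uc'.
have : w \in s ++ u :: t by rewrite -defc.
rewrite mem_cat inE => /or3P [ws|/eqP wu|wt].
- have [s' [s'' defs]] := mem_cat_cons ws.
  rewrite defs -catA in defc; apply: (ordered w u _ _ defc) => //; last by rewrite e_sym.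
  by rewrite mem_cat mem_head orbT.
- by rewrite wu e_irr in euw.
- exact: (ordered u w s t).
Qed.

(** A chord cuts the cycle into two shorter cycles; the one that keeps the edge
[k k'] contains a triangle on it by induction. *)
Lemma cycle_edge_triangle (k k' : T) (q : seq T) :
  ucycle e (k :: k' :: q) -> q != [::] ->
  exists z, [/\ z \in q, e k z & e k' z].
Proof.
have [n le_n] := ubnP (size q); elim: n q le_n => // n IH q le_n cc q0.
have [q1|q2] := leqP (size q) 1.
  case: q q0 cc q1 {le_n} => [//|z [|//]] _ /andP [/=] /and4P [_ ekz ezk _] _ _.
  by exists z; rewrite mem_head e_sym.
have [|s1 [s2 [s3 [u [w [defc euw s20 s130]]]]]] := chord_split cc; first by [].
case: s1 => [|k0 s1] /= in defc s130 *.
  case: s2 => [//|k0 s2] /= in defc s20; case: defc => ku k0k' defq.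
  subst u k0.
  have [|||z [zq ekz ek'z]] := IH (rcons s2 w).
  - by rewrite size_rcons; move: le_n; rewrite defq size_cat /=; lia.
  - case/andP: cc => /= /andP [ekk'].
    rewrite defq -cat_rcons rcons_cat cat_path => /andP [pp _] ucc.
    rewrite /ucycle /= ekk' rcons_path pp last_rcons e_sym euw /=.
    move: ucc; rewrite !inE !negb_or !mem_cat !cat_uniq !negb_or.
    by case/and3P=> /and3P [-> -> _] /andP [-> _] /and3P [-> _ _].
  - by case: (s2).
  - by exists z; rewrite defq -cat_rcons mem_cat zq.
case: defc => kk0 defq; subst k0.
have [q' defq' sz] : exists2 q', k' :: q' = s1 ++ u :: w :: s3
    & (subseq q' q && (0 < size q' < size q)).
  move: defq; case: (s1) => [|k0 s1'] /= [k'u ->].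
    exists (w :: s3); rewrite ?k'u // suffix_subseq size_cat /=.
    by move: s20; lia.
  exists (s1' ++ u :: w :: s3); first by rewrite k'u.
  rewrite cat_subseq ?subseq_refl //= ?eqxx ?suffix_subseq //=.
  rewrite !size_cat /= size_cat /=.
  by move: s20; lia.
case/and3P: sz => sub q'0 q'q.
have [|||z [zq ekz ek'z]] := IH q'.
- lia.
- case/andP: cc => cc ucc; apply/andP; split; last first.
    by apply: subseq_uniq ucc; rewrite /= !eqxx.
  change (path e k (rcons (k' :: q') k)); rewrite defq'.
  change (is_true (path e k (rcons (k' :: q) k))) in cc; move: cc; rewrite defq.
  rewrite !rcons_cat !cat_path /= rcons_cat cat_path /=.
  by case/and5P=> -> -> _ _ ->; rewrite euw.
- by rewrite -size_eq0 -lt0n.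
- by exists z; rewrite (mem_subseq sub).
Qed.

Lemma del_rel_path (X : {set T}) x p :
  path (del_rel e X) x p -> path e x p && all [predC X] p.
Proof.
elim: p x => [//|y p IH] x /= /andP [/and3P [_ yX ->] /IH /andP [-> ->]].
by rewrite yX.
Qed.

(** Take [x] in [C] with as many neighbours in [K] as possible. If [x] misses
[k], walk inside [C] from [x] to the first neighbour [z] of [k]. Every neighbour
[k'] of [x] in [K] closes a cycle through [k k'], and [z] is the only vertex of
the walk adjacent to [k], so [z] is adjacent to [k'] by [cycle_edge_triangle].
Thus [z] has more neighbours in [K] than [x]. *)
Lemma chordal_dominating (K C : {set T}) :
  {in K &, forall k k', k != k' -> e k k'} -> [disjoint K & C] -> C != set0 ->
  {in C &, forall x y, connect (del_rel e (~: C)) x y} ->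
  {in K, forall k, exists2 x, x \in C & e k x} ->
  exists2 x, x \in C & {in K, forall k, e x k}.
Proof.
move=> Kcl KC /set0Pn [x0 x0C] Cconn Knb.
pose N x := [set k in K | e x k].
case: (arg_maxnP (fun x => #|N x|) (x0C : (fun x => x \in C) x0)) => x xC xmax.
exists x => // k kK; apply/negPn/negP => exk.
have [y yC eky] := Knb k kK.
have /connectP [p0 pp0 defy] := Cconn x y xC yC.
case: (shortenP pp0) defy => p pp up _ defy {pp0 p0}.
have haskp : has (e k) p.
  move: eky; rewrite defy; case: (p) => [|z q ekz]; first by rewrite e_sym (negbTE exk).
  by apply/hasP; exists (last x (z :: q)) => //=; rewrite mem_last.
case/andP: (del_rel_path pp) => {}pp pC {defy}.
case: (split_find haskp) pp up pC => z p1 p2 ekz nhas.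
rewrite cat_path -cat_cons cat_uniq all_cat => /andP [pp _] /andP [up _] /andP [pC _].
have notC k0 : k0 \in K -> k0 \notin x :: rcons p1 z.
  move=> k0K; apply: contraL k0K; rewrite inE => /predU1P [->|/(allP pC) /=].
    by apply: contraL xC => /(disjointFr KC) ->.
  by rewrite !inE negbK => k0C; apply: contraL k0C => /(disjointFr KC) ->.
have zC : z \in C.
  by have := allP pC z; rewrite mem_rcons mem_head /= inE negbK; apply.
suff sub : k |: N x \subset N z.
  have := leq_trans (subset_leq_card sub) (xmax z zC).
  by rewrite cardsU1 inE (negbTE exk) andbF add1n ltnn.
apply/subsetP => k'; rewrite !inE => /predU1P [->|/andP [k'K exk']].
  by rewrite kK e_sym.
rewrite k'K /=; have [|//|w [wp ekw ek'w]] := @cycle_edge_triangle k k' (x :: rcons p1 z).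
  have kk' : k != k' by apply: contraNneq exk => ->.
  apply/andP; split.
    by rewrite /= rcons_path last_rcons pp Kcl //= e_sym exk' e_sym ekz.
  by rewrite cons_uniq inE negb_or kk' notC //= -/(uniq (x :: _)) up notC.
move: wp; rewrite inE mem_rcons inE => /or3P [/eqP wx|/eqP <-|wp1].
- by rewrite e_sym -wx ekw in exk.
- by rewrite e_sym.
- by case/hasP: nhas; exists w.
Qed.

(** * Toughness and separation *)

Notation conn X := (connect (del_rel e X)).

Lemma conn_sym (X : {set T}) : connect_sym (del_rel e X).
Proof. by apply: sym_connect_sym => x y; rewrite /del_rel /= andbCA e_sym. Qed.

(** For [D] disjoint from [X], this makes [D] a union of components of the graph
without [X]. *)
Definition sealed (X D : {set T}) :=
  forall y z, y \in D -> e y z -> z \in D :|: X.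

(** Walks from [D] in the graph without [X] stay in [D]; note that [conn (~: D)]
is connectedness inside [D]. *)
Lemma sealed_conn (X D : {set T}) y z :
  sealed X D -> y \in D -> conn X y z -> (z \in D) && conn (~: D) y z.
Proof.
move=> sD yD /connectP [p + ->]; elim: p y yD => [|w p IH] y yD /=.
  by rewrite yD connect0.
case/andP=> /and3P [_ wX eyw] pp.
have wD : w \in D by have := sD _ _ yD eyw; rewrite inE (negbTE wX) orbF.
have /andP [-> c] := IH w wD pp; rewrite /=.
by apply: connect_trans c; apply: connect1; rewrite /del_rel /= !inE !negbK yD wD.
Qed.

(** The vertices of [Y] lie in distinct components of the graph without [X], so
[X] is separating and its ratio bounds the toughness. *)
Lemma tough_separated (X : {set T}) (Y : seq T) :
  all [predC X] Y -> pairwise (fun x y => ~~ conn X x y) Y ->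
  1 < size Y -> size Y < #|X|.
Proof.
move=> YX Ypw Y1.
have Yroot : uniq [seq fingraph.root (del_rel e X) x | x <- Y].
  rewrite uniq_pairwise pairwise_map.
  by apply: sub_pairwise Ypw => x y /=; rewrite (fingraph.root_connect (@conn_sym X)).
have nc : size Y <= ncomp_del e X.
  rewrite -(size_map (fingraph.root (del_rel e X))) /ncomp_del /n_comp_mem.
  rewrite cardE; apply: uniq_leq_size => // _ /mapP [x xY ->].
  rewrite mem_enum !inE (fingraph.roots_root (@conn_sym X)) /=.
  have xX := allP YX x xY; rewrite /= in xX.
  have /connectP [p + ->] := connect_root (del_rel e X) x.
  elim/last_ind: p => [//|p w _]; rewrite rcons_path last_rcons => /andP [_].
  by case/and3P.
have sepX : separating e X by rewrite /separating (leq_trans Y1).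
apply: (leq_ltn_trans nc); rewrite ltnNge; apply/negP => le.
move: e_tough; rewrite /toughness (bigD1 X) //= lt_min => /andP [+ _].
rewrite lte_fin ltr_pdivlMr ?ltr0n ?(leq_trans _ sepX) // mul1r ltr_nat.
by rewrite ltnNge le.
Qed.

Lemma sealed_component (X K : {set T}) y :
  y \notin X -> (forall z k, conn X y z -> k \in X -> e z k -> k \in K) ->
  sealed K [set z | conn X y z].
Proof.
move=> yX nb z w; rewrite !inE => yz ezw.
case: (boolP (w \in X)) => [wX|wX]; first by rewrite (nb z w) ?orbT.
have zX : z \notin X.
  rewrite -in_setC; have sC : sealed X (~: X) by move=> *; rewrite !inE orNb.
  have yC : y \in ~: X by rewrite inE.
  by case/andP: (sealed_conn sC yC yz).
apply/orP; left; apply: connect_trans yz (connect1 _).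
by rewrite /del_rel /= zX wX.
Qed.

Lemma sealedS (X Y D : {set T}) : X \subset Y -> sealed X D -> sealed Y D.
Proof.
move=> XY sD y z yD eyz; have := sD y z yD eyz.
by rewrite !inE => /orP [->//|/(subsetP XY) ->]; rewrite orbT.
Qed.

Lemma sealed_not_conn (X D : {set T}) y z :
  sealed X D -> y \in D -> z \notin D -> ~~ conn X y z.
Proof. by move=> sD yD; apply: contra => /(sealed_conn sD yD) /andP []. Qed.

Lemma card_set_seq (s : seq T) : #|[set z in s]| <= size s.
Proof. by rewrite cardsE card_size. Qed.

Lemma sealed_pair (X D : {set T}) y z :
  sealed X D -> y \in D -> y \notin X -> z \notin D -> z \notin X -> 2 < #|X|.
Proof.
move=> sD yD yX zD zX; apply: (@tough_separated X [:: y; z]) => //=.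
  by rewrite yX zX.
by rewrite (sealed_not_conn sD).
Qed.

(** Otherwise [X], of at most three vertices, would separate [y], [y'] and [z]. *)
Lemma sealed_connected (X D : {set T}) y y' z :
  #|X| <= 3 -> sealed X D -> [disjoint D & X] -> z \notin D -> z \notin X ->
  y \in D -> y' \in D -> conn (~: D) y y'.
Proof.
move=> X3 sD DX zD zX yD y'D; apply: contraLR X3 => nyy'; rewrite -ltnNge.
apply: (@tough_separated X [:: y; y'; z]) => //=.
  by rewrite (disjointFr DX yD) (disjointFr DX y'D) zX.
rewrite (sealed_not_conn sD yD zD) (sealed_not_conn sD y'D zD) !andbT.
by apply: contra nyy' => /(sealed_conn sD yD) /andP [].
Qed.

(** * Regions of a triangle *)

Record region (a b c : T) (C : {set T}) : Prop := Region {
  region_triangle : [/\ e a b, e a c & e b c];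
  region_out : [/\ a \notin C, b \notin C & c \notin C];
  region_conn : {in C &, forall x y, conn (~: C) x y};
  region_sealed : sealed [set z in [:: a; b; c]] C }.

Lemma region_swap12 a b c C : region a b c C -> region b a c C.
Proof.
case=> -[ab ac bc] [aC bC cC] cC' sC; split=> //; first by rewrite e_sym.
by apply: sealedS sC; apply/subsetP => z; rewrite !inE orbCA.
Qed.

Lemma region_swap23 a b c C : region a b c C -> region a c b C.
Proof.
case=> -[ab ac bc] [aC bC cC] cC' sC; split=> //; first by split; rewrite // e_sym.
by apply: sealedS sC; apply/subsetP => z; rewrite !inE (orbC (z == c)).
Qed.

(** Otherwise [b] and [c] would separate [a] from [C]. *)
Lemma region_nb a b c C : region a b c C -> C != set0 -> exists2 x, x \in C & e a x.
Proof.
case=> -[ab ac _] [aC bC cC] _ sC /set0Pn [y yC].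
case: (pickP [pred x | (x \in C) && e a x]) => [x /andP [xC ax]|nb]; first by exists x.
have sC' : sealed [set z in [:: b; c]] C.
  move=> w z wC ewz; have := sC w z wC ewz; rewrite !inE.
  by case: eqP ewz => // -> ewa; have:= nb w; rewrite /= wC e_sym ewa.
have yX : y \notin [set z in [:: b; c]].
  by rewrite !inE negb_or !(contraTneq _ yC) // => ->.
have aX : a \notin [set z in [:: b; c]].
  by rewrite !inE negb_or !(contraTneq _ isT) // => eqa; rewrite -eqa e_irr in ab ac.
by have := sealed_pair sC' yC yX aC aX; rewrite ltnNge card_set_seq.
Qed.

Definition region_children a b c (C : {set T}) x (Da Db Dc : {set T}) :=
  [/\ region x b c Da, region x a c Db, region x a b Dc &
      forall z, (z \in C) = (x == z) + (z \in Da) + (z \in Db) + (z \in Dc) :> nat].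

(** [Da] is the set of the vertices of [C] other than [x] whose component in the
graph without [a], [b], [c], [x] has no neighbour of [a]; likewise [Db] and
[Dc]. A component with neighbours of all four would contain a vertex adjacent to
all four, giving a K5. One that misses two of them would be cut off by the other
two. *)
Lemma region_split a b c C : region a b c C -> C != set0 ->
  exists x Da Db Dc, region_children a b c C x Da Db Dc /\
    ((exists2 o, o \notin C & o \notin [:: a; b; c]) ->
     [\/ Da = set0, Db = set0 | Dc = set0]).
Proof.
move=> rC C0; case: (rC) => -[ab ac bc] [aC bC cC] Cconn sC.
have nba := region_nb rC C0.
have nbb := region_nb (region_swap12 rC) C0.
have nbc := region_nb (region_swap12 (region_swap23 rC)) C0.
have ba : e b a by rewrite e_sym. have ca : e c a by rewrite e_sym.
have cb : e c b by rewrite e_sym.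
have [x xC xK] : exists2 x, x \in C & {in [set z in [:: a; b; c]], forall k, e x k}.
  apply: chordal_dominating => //.
  - by move=> k k'; rewrite !inE => /or3P [] /eqP -> /or3P [] /eqP ->; rewrite ?eqxx.
  - by rewrite disjoints_subset; apply/subsetP => z; rewrite !inE => /or3P [] /eqP ->.
  - by move=> k; rewrite !inE => /or3P [] /eqP ->.
have [xa xb xc] : [/\ e x a, e x b & e x c] by split; apply: xK; rewrite !inE eqxx ?orbT.
pose K := [set z in [:: a; b; c; x]].
pose D k := [set y in C :\ x | [forall z, conn K y z ==> ~~ e z k]].
have CK y : y \in C :\ x -> y \notin K.
  rewrite !inE !negb_or => /andP [-> yC]; rewrite andbT.
  by rewrite !(contraTneq _ yC) // => ->.
have sCx : sealed K (C :\ x).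
  move=> y z; rewrite !inE => /andP [_ yC] eyz; have := sC y z yC eyz.
  by rewrite !inE; case: (z == x); rewrite ?orbT ?orbF.
have inD k y : y \in D k -> y \in C :\ x /\ forall z, conn K y z -> ~~ e z k.
  by rewrite inE => /andP [yC /forallP far]; split=> // z; apply/implyP/far.
have sD k : sealed (K :\ k) (D k).
  move=> y z /inD [yCx far] eyz; rewrite in_setU in_setD1.
  have zk : z != k by apply: contraTneq eyz => ->; apply: far; apply: connect0.
  have := sCx y z yCx eyz; rewrite in_setU zk => /orP [zCx|->]; last by rewrite orbT.
  apply/orP; left; rewrite inE zCx; apply/forallP => w.
  apply/implyP => zw; apply: far; apply: connect_trans zw.
  by rewrite connect1 // /del_rel /= eyz !CK.
have KD k p q r : [:: p; q; r; k] =i [:: a; b; c; x] ->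
    K :\ k \subset [set z in [:: p; q; r]].
  move=> pE; apply/subsetP => z; rewrite in_setD1 /K !in_set -pE !inE.
  by rewrite !orbA => /andP [/negbTE ->]; rewrite orbF.
have DC k : D k \subset C :\ x by apply/subsetP => y /inD [].
have rD k p q : [:: x; p; q; k] =i [:: a; b; c; x] -> k \notin C ->
    e p q -> e k p -> e k q -> e x p -> e x q -> p \notin C -> q \notin C ->
    region x p q (D k).
  move=> /KD sub kC pq kp kq xp xq pC qC.
  have sDk : sealed [set z in [:: x; p; q]] (D k) by apply: sealedS (sD k).
  have notD z : z \notin C -> z \notin D k.
    by apply: contra => /(subsetP (DC k)); rewrite inE => /andP [].
  have xD : x \notin D k by apply/negP => /(subsetP (DC k)); rewrite !inE eqxx.
  split=> //; first by rewrite xD !notD.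
  have kX : k \notin [set z in [:: x; p; q]].
    rewrite !inE !negb_or (contraTneq _ xC) /=; last by move=> <-.
    by apply/andP; split; apply: contraTneq isT => ek; rewrite ek e_irr in kp kq.
  move=> y y' yD y'D; apply: sealed_connected sDk _ (notD k kC) kX yD y'D.
    exact: card_set_seq.
  rewrite disjoint_sym disjoints_subset; apply/subsetP => z.
  rewrite in_setC in_set !in_cons in_nil orbF => /or3P [] /eqP ->; by rewrite ?xD ?notD.
have comp_sealed y (K' : {set T}) : y \in C :\ x ->
    (forall z k, conn K y z -> k \in K -> e z k -> k \in K') ->
    sealed K' [set z | conn K y z].
  by move=> yC; apply: sealed_component; apply: CK.
have compC y z : y \in C :\ x -> conn K y z -> z \in C :\ x.
  by move=> yC /(sealed_conn sCx yC) /andP [].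
have kK k : k \in [:: a; b; c; x] -> k \in K by rewrite in_set.
(* Otherwise the component of [y] has neighbours of [a], [b] and [c], and one of
   [x] because [C] is connected. *)
have cover y : y \in C :\ x -> [|| y \in D a, y \in D b | y \in D c].
  move=> yCx; apply/negPn/negP; rewrite !negb_or => /and3P [yDa yDb yDc].
  pose Y := [set z | conn K y z].
  have yY : y \in Y by rewrite inE connect0.
  have sY : sealed K Y by apply: comp_sealed.
  have YC : Y \subset C :\ x by apply/subsetP => z; rewrite inE; apply: compC.
  have nbD k : y \notin D k -> exists2 z, z \in Y & e k z.
    rewrite inE yCx /= => /forallPn [z]; rewrite negb_imply negbK => /andP [yz ezk].
    by exists z; rewrite ?inE // e_sym.
  have xY : x \notin Y by apply/negP => /(subsetP YC); rewrite !inE eqxx.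
  have [z zY zK] : exists2 z, z \in Y & {in K, forall k, e z k}.
    apply: chordal_dominating.
    - by move=> k k'; rewrite !inE => /or4P [] /eqP -> /or4P [] /eqP ->;
        rewrite ?eqxx // e_sym.
    - rewrite disjoint_sym disjoints_subset; apply/subsetP => z /(subsetP YC) zCx.
      by rewrite in_setC CK.
    - by apply/set0Pn; exists y.
    - move=> z w zY wY; have yz : conn K y z by rewrite inE in zY.
      have yw : conn K y w by rewrite inE in wY.
      have zw : conn K z w by apply: connect_trans yw; rewrite conn_sym.
      by case/andP: (sealed_conn sY zY zw).
    - move=> k; rewrite in_set !in_cons in_nil orbF => /or4P [] /eqP ->; try exact: nbD.
      case: (pickP [pred z | (z \in Y) && e x z]) => [z /andP [zY xz]|nox].
        by exists z.
      have sY' : sealed (~: C) Y.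
        move=> w w' wY eww'; have := sY w w' wY eww'; rewrite !in_setU.
        case/orP=> [->//|]; rewrite in_set !in_cons in_nil orbF in_setC.
        case/or4P=> /eqP w'E; rewrite w'E ?aC ?bC ?cC ?orbT //.
        by have := nox w; rewrite /= wY e_sym -w'E eww'.
      have yC : y \in C by case/setD1P: yCx.
      by case/negP: xY; case/andP: (sealed_conn sY' yY (Cconn y x yC xC)).
  have [zx zC] := setD1P (subsetP YC z zY).
  have := @K5_free [:: z; a; b; c; x] erefl.
  have ax : e a x by rewrite e_sym. have bx : e b x by rewrite e_sym.
  have cx : e c x by rewrite e_sym.
  rewrite /= ab ac bc ax bx cx !zK ?kK ?inE ?eqxx ?orbT //=.
(* A component without neighbours of [k] and [k'] would be cut off from [k] by the
   remaining vertices [p] and [x]. *)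
have disj k k' p : [:: p; x; k; k'] =i [:: a; b; c; x] -> e k k' -> e k p ->
    k \notin C -> [disjoint D k & D k'].
  move=> KE kk' kp kC; rewrite disjoints_subset; apply/subsetP => y.
  move=> /inD [yCx nk]; rewrite in_setC; apply/negP => /inD [_ nk'].
  pose Y := [set z | conn K y z].
  have yY : y \in Y by rewrite inE connect0.
  have sY : sealed [set z in [:: p; x]] Y.
    apply: comp_sealed => // z q yz; rewrite /K !in_set -KE !inE => qK ezq.
    case/or4P: qK => /eqP qE; rewrite qE ?eqxx ?orbT //.
      by have := nk z yz; rewrite -qE ezq.
    by have := nk' z yz; rewrite -qE ezq.
  have notY q : q \in K -> q \notin Y.
    by move=> qK; apply/negP; rewrite inE => /(compC _ _ yCx) /CK; rewrite qK.
  have kX : k \notin [set z in [:: p; x]].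
    rewrite !inE negb_or; apply/andP; split.
      by apply: contraTneq kp => ->; rewrite e_irr.
    by apply: contraNneq kC => ->.
  have yX : y \notin [set z in [:: p; x]].
    apply: contra (CK _ yCx); rewrite /K !in_set -KE !inE => /orP [] ->; by rewrite ?orbT.
  have kY : k \notin Y by apply: notY; rewrite /K in_set -KE !inE eqxx !orbT.
  by have := sealed_pair sY yY yX kY kX; rewrite ltnNge card_set_seq.
have abD : [disjoint D a & D b].
  by apply: (disj a b c) => //; move=> z; rewrite !inE; do 4?case: (z == _).
have acD : [disjoint D a & D c].
  by apply: (disj a c b) => //; move=> z; rewrite !inE; do 4?case: (z == _).
have bcD : [disjoint D b & D c].
  by apply: (disj b c a) => //; move=> z; rewrite !inE; do 4?case: (z == _).
exists x, (D a), (D b), (D c); split.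
  split.
  - by apply: rD => //; move=> z; rewrite !inE; do 4?case: (z == _).
  - by apply: rD => //; move=> z; rewrite !inE; do 4?case: (z == _).
  - by apply: rD => //; move=> z; rewrite !inE; do 4?case: (z == _).
  move=> z; case: (boolP (z \in C :\ x)) => [zCx|zCx].
    have := cover z zCx; have [/negbTE xz zC] := setD1P zCx.
    rewrite zC eq_sym xz; case: (boolP (z \in D a)) => [zDa _|_].
      by rewrite (disjointFr abD zDa) (disjointFr acD zDa).
    by case: (boolP (z \in D b)) => [zDb _|_ /= -> //]; rewrite (disjointFr bcD zDb).
  have notD k : z \in D k = false by apply: contraNF zCx; apply: (subsetP (DC k)).
  rewrite !notD !addn0; move: zCx; rewrite in_setD1 negb_and negbK eq_sym.
  by case: eqP => [<- _|_ /= /negbTE ->]; rewrite ?xC.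
(* Otherwise [K] would separate [o] and one vertex of each subregion. *)
case=> o oC oabc; have [Da0|[ya yaD]] := set_0Vmem (D a); first by constructor 1.
have [Db0|[yb ybD]] := set_0Vmem (D b); first by constructor 2.
have [Dc0|[yc ycD]] := set_0Vmem (D c); first by constructor 3.
have sDK k : sealed K (D k) by apply: sealedS (sD k); apply: subD1set.
have DK k y : y \in D k -> y \notin K by move=> /(subsetP (DC k)) /CK.
have oD k : o \notin D k.
  by apply: contra oC => /(subsetP (DC k)); rewrite inE => /andP [].
have ox : o != x by apply: contraNneq oC => ->.
have oK : o \notin K.
  by move: oabc; rewrite /K in_set !inE (negbTE ox) orbF.
have : size [:: ya; yb; yc; o] < #|K|.
  apply: tough_separated => //=; first by rewrite (DK a) // (DK b) // (DK c) // oK.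
  have nc k y z : y \in D k -> z \notin D k -> ~~ conn K y z.
    exact: sealed_not_conn.
  by rewrite !(nc a ya, nc b yb, nc c yc) // ?(disjointFl abD ybD)
    ?(disjointFl acD ycD) ?(disjointFl bcD ycD).
by rewrite ltnNge card_set_seq.
Qed.

(** A vertex outside the region and its triangle lies in a further component
once the triangle and [x] are removed, and this is what forces a subregion to be
empty in [region_split]. The subregions are always proper, since each leaves out a
vertex of the triangle. *)
Definition proper_region a b c (C : {set T}) :=
  region a b c C /\ exists2 o, o \notin C & o \notin [:: a; b; c].

Lemma proper_swap12 a b c C : proper_region a b c C -> proper_region b a c C.
Proof.
case=> /region_swap12 rC [q qC qK]; split=> //; exists q => //.
by move: qK; rewrite !inE orbCA.
Qed.

Lemma proper_swap23 a b c C : proper_region a b c C -> proper_region a c b C.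
Proof.
case=> /region_swap23 rC [q qC qK]; split=> //; exists q => //.
by move: qK; rewrite !inE (orbC (q == b)).
Qed.

Lemma proper_split a b c C : region a b c C -> C != set0 ->
  exists x Da Db Dc,
  [/\ [/\ proper_region x b c Da, proper_region x a c Db & proper_region x a b Dc],
      [/\ #|Da| < #|C|, #|Db| < #|C| & #|Dc| < #|C|],
      forall z, (z \in C) = (x == z) + (z \in Da) + (z \in Db) + (z \in Dc) :> nat &
      proper_region a b c C -> [\/ Da = set0, Db = set0 | Dc = set0]].
Proof.
move=> rC C0; have [x [Da [Db [Dc [[rDa rDb rDc cnt] one]]]]] := region_split rC C0.
case: (rC) => -[ab ac bc] [aC bC cC] _ _.
have xC : x \in C by have := cnt x; rewrite eqxx; case: (x \in C).
have irr p q : e p q -> (p == q) = false.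
  by move=> epq; apply: contraTF epq => /eqP ->; rewrite e_irr.
have out k : k \notin C -> [/\ k \notin Da, k \notin Db & k \notin Dc].
  by move=> kC; have := cnt k; rewrite (negbTE kC); do !case: (k \in _); case: (x == k).
have kx k : k \notin C -> (k == x) = false by apply: contraNF => /eqP ->.
have small (D : {set T}) : (forall z, (z \in D) + (x == z) <= (z \in C)) -> #|D| < #|C|.
  move=> sub; apply: proper_card; apply/properP; split.
    by apply/subsetP => z zD; have := sub z; rewrite zD; case: (z \in C).
  by exists x => //; have := sub x; rewrite eqxx xC; case: (x \in D).
exists x, Da, Db, Dc; split=> //; last by case.
- split; split=> //.
  + by exists a; [case: (out a aC) | rewrite !inE kx // !irr].
  + by exists b; [case: (out b bC) | rewrite !inE kx // irr ?(irr b c) // e_sym].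
  + by exists c; [case: (out c cC) | rewrite !inE kx // !irr // e_sym].
- by split; apply: small => z; rewrite cnt; clear; lia.
Qed.

(** * Paths through a region *)

(** A path from [a] to [b] whose interior is exactly [D]. Counting occurrences
expresses both that the interior covers [D] and that it has no repetition, and
turns the composition of paths into linear arithmetic. *)
Definition link a b (D : {set T}) :=
  exists2 s, path e a (rcons s b) & forall z, count_mem z s = (z \in D).

Lemma link_sym a b (D : {set T}) : link a b D -> link b a D.
Proof.
case=> s ps cs; exists (rev s); last by move=> z; rewrite count_rev.
rewrite -rev_path in ps; move: ps.
by rewrite last_rcons belast_rcons rev_cons (eq_path (e' := e)) // => p q; rewrite /= e_sym.
Qed.

Lemma rcons_path_cat a s b t : path e a (s ++ b :: t) = path e a (rcons s b) && path e b t.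
Proof. by rewrite -cat_rcons cat_path last_rcons. Qed.

(** The path goes from [a] to [b] through [x]. The edge [a x] lies on the
triangles [xac] and [xab], and [x b] on [xbc] and [xab], so any two of the three
subregions can be put on different edges. *)
Lemma link_region a b c C : proper_region a b c C -> link a b C.
Proof.
have [n] := ubnP #|C|; elim: n a b c C => // n IH a b c C le_n pC.
have [-> |C0] := eqVneq C set0.
  exists [::]; last by move=> z; rewrite in_set0.
  by case: pC => -[[ab _ _] _ _ _] _ /=; rewrite ab.
case: (pC) => rC _.
have [x [Da [Db [Dc [[rDa rDb rDc] [lDa lDb lDc] cnt one]]]]] := proper_split rC C0.
have {}IH p q r (D : {set T}) : #|D| < #|C| -> proper_region p q r D -> link p q D.
  by move=> lD; apply: IH; exact: leq_trans lD le_n.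
have cat (D1 D2 : {set T}) : link a x D1 -> link x b D2 ->
    (forall z, (z \in C) = (x == z) + (z \in D1) + (z \in D2) :> nat) -> link a b C.
  move=> [s1 p1 c1] [s2 p2 c2] cC; exists (s1 ++ x :: s2).
    by rewrite rcons_cat rcons_path_cat p1.
  by move=> z; rewrite count_cat /= c1 c2 cC; clear; lia.
have [D0|D0|D0] := one pC.
- apply: (cat Db Dc).
  + exact: IH (proper_swap12 rDb).
  + exact: IH (proper_swap23 rDc).
  + by move=> z; rewrite cnt D0 in_set0 addn0.
- apply: (cat Dc Da).
  + exact: IH (proper_swap12 rDc).
  + exact: IH rDa.
  + by move=> z; rewrite cnt D0 in_set0; clear; lia.
- apply: (cat Db Da).
  + exact: IH (proper_swap12 rDb).
  + exact: IH rDa.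
  + by move=> z; rewrite cnt D0 in_set0; clear; lia.
Qed.

Definition links a b c C := [/\ link a b C, link a c C & link b c C].

Lemma links_region a b c C : proper_region a b c C -> links a b c C.
Proof.
move=> pC; split; first exact: link_region pC.
  exact: link_region (proper_swap23 pC).
exact: link_region (proper_swap23 (proper_swap12 pC)).
Qed.

(** A path from [a] to [v] that uses the edge [b c] in one of its directions and
passes [m w] times through each vertex [w]. *)
Definition traverses a b c v (m : T -> nat) := exists y z s t,
  [/\ (y, z) = (b, c) \/ (y, z) = (c, b), path e a (s ++ [:: y, z & t]),
      last z t = v & forall w, count_mem w (a :: s ++ [:: y, z & t]) = m w].

Lemma traverses_sym a b c v m : traverses a b c v m -> traverses a c b v m.
Proof. by case=> y [z [s [t [yz p l cn]]]]; exists y, z, s, t; split=> //; case: yz; tauto. Qed.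

Lemma traverses_eq a b c v m m' : m =1 m' -> traverses a b c v m -> traverses a b c v m'.
Proof.
by move=> mm' [y [z [s [t [yz p l cn]]]]]; exists y, z, s, t; split=> // w; rewrite cn mm'.
Qed.

Lemma traverses_join a b c v (D1 D2 : {set T}) : link a b D1 -> e b c -> link c v D2 ->
  traverses a b c v
    (fun w => (a == w) + (b == w) + (c == w) + (v == w) + (w \in D1) + (w \in D2)).
Proof.
move=> [s1 p1 c1] bc [s2 p2 c2]; exists b, c, s1, (rcons s2 v).
split; [by left | by rewrite rcons_path_cat p1 /= bc | by rewrite last_rcons |].
by move=> w; rewrite /= count_cat /= -cats1 count_cat c1 c2 /=; clear; lia.
Qed.

Lemma traverses_prepend a x b c v m (D : {set T}) : traverses x b c v m -> link a x D ->
  traverses a b c v (fun w => (a == w) + (w \in D) + m w).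
Proof.
move=> [y [z [s [t [yz p l cn]]]]] [s1 p1 c1]; exists y, z, (s1 ++ x :: s), t.
split=> //; first by rewrite -catA cat_cons rcons_path_cat p1.
by move=> w; rewrite -cn /= -catA count_cat /= c1; clear; lia.
Qed.

(** The edge [x c] is replaced by a link from [x] to [b] and the edge [b c]. *)
Lemma traverses_detour a x b c v m (D : {set T}) : traverses a x c v m -> e b c -> link x b D ->
  traverses a b c v (fun w => (b == w) + (w \in D) + m w).
Proof.
move=> [y [z [s [t [yz p l cn]]]]] bc lD; case: yz => -[yE zE]; subst y z.
  case: lD => s1 p1 c1; exists b, c, (s ++ x :: s1), t; split=> //; first by left.
    move: p; rewrite -catA cat_cons !rcons_path_cat p1 /= bc /=.
    by case/and3P=> -> _ ->.
  by move=> w; rewrite -cn /= -catA !count_cat /= ?count_cat c1 /=; clear; lia.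
case: (link_sym lD) => s1 p1 c1; exists c, b, s, (s1 ++ x :: t); split=> //; first by right.
- move: p; rewrite !rcons_path_cat /= rcons_path_cat p1 (e_sym c b) bc /=.
  by case/and3P=> -> _ ->.
- by rewrite last_cat.
- by move=> w; rewrite -cn /= !count_cat /= ?count_cat c1 /=; clear; lia.
Qed.

Definition route a v (m : T -> nat) :=
  exists p, [/\ path e a p, last a p = v & forall w, count_mem w (a :: p) = m w].

(** The distinguished edge is replaced by a link. *)
Lemma traverses_absorb a b c v m (D : {set T}) : traverses a b c v m -> link b c D ->
  route a v (fun w => (w \in D) + m w).
Proof.
move=> [y [z [s [t [yz p l cn]]]]] lD.
have [s1 p1 c1] : link y z D by case: yz => -[-> ->] //; apply: link_sym.
exists (s ++ y :: s1 ++ z :: t); split.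
- by move: p; rewrite !rcons_path_cat p1 /= => /and3P [-> _ ->].
- by rewrite last_cat /= last_cat.
- by move=> w; rewrite -cn /= !count_cat /= ?count_cat c1 /=; clear; lia.
Qed.

(** If [v] is [x], take [a b c x] or [a c b x], whichever can carry the two
nonempty subregions on its first and last edges. If [v] is in [Da], go from [a]
to [x] and apply induction to the triangle [x b c]. If [v] is in [Db], apply
induction to [a x c] and pass through [b] on the way along the edge [x c]; the
case of [Dc] is symmetric. *)
Lemma traverses_region a b c v (C : {set T}) : proper_region a b c C -> v \in C ->
  traverses a b c v (fun w => (a == w) + (b == w) + (c == w) + (w \in C)).
Proof.
have [n] := ubnP #|C|; elim: n a b c C => // n IH a b c C le_n pC vC.
have C0 : C != set0 by apply/set0Pn; exists v.
case: (pC) => rC _; case: (rC) => -[ab ac bc] _ _ _.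
have [x [Da [Db [Dc [[rDa rDb rDc] [lDa lDb lDc] cnt one]]]]] := proper_split rC C0.
have {}IH p q r (D : {set T}) : #|D| < #|C| -> proper_region p q r D -> v \in D ->
    traverses p q r v (fun w => (p == w) + (q == w) + (r == w) + (w \in D)).
  by move=> lD; apply: IH; exact: leq_trans lD le_n.
have [axb axc abc] := links_region rDa.
have [bxa bxc bac] := links_region rDb.
have [cxa cxb cab] := links_region rDc.
have cb : e c b by rewrite e_sym.
have in0 (D : {set T}) : D = set0 -> forall w, w \in D = false by move=> -> w; rewrite in_set0.
have : [\/ x = v, v \in Da, v \in Db | v \in Dc].
  have := cnt v; rewrite vC; case: eqP => [->|_]; first by constructor.
  by do 3?case: (v \in _); try by [constructor 2|constructor 3|constructor 4].
case=> [xv|vD|vD|vD].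
- subst v; have [/in0 D0|/in0 D0|/in0 D0] := one pC.
  + apply: traverses_eq (traverses_join cab bc (link_sym bxc)) => w.
    by rewrite cnt D0; clear; lia.
  + apply: traverses_eq (traverses_join cab bc (link_sym axc)) => w.
    by rewrite cnt D0; clear; lia.
  + apply: traverses_sym.
    apply: traverses_eq (traverses_join bac cb (link_sym axb)) => w.
    by rewrite cnt D0; clear; lia.
- have tv := IH _ _ _ _ lDa rDa vD; have [/in0 D0|/in0 D0|/in0 D0] := one pC.
  + by rewrite D0 in vD.
  + by apply: traverses_eq (traverses_prepend tv (link_sym cxa)) => w; rewrite cnt D0; clear; lia.
  + by apply: traverses_eq (traverses_prepend tv (link_sym bxa)) => w; rewrite cnt D0; clear; lia.
- have tv := IH _ _ _ _ lDb (proper_swap12 rDb) vD; have [/in0 D0|/in0 D0|/in0 D0] := one pC.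
  + by apply: traverses_eq (traverses_detour tv bc cxb) => w; rewrite cnt D0; clear; lia.
  + by rewrite D0 in vD.
  + by apply: traverses_eq (traverses_detour tv bc axb) => w; rewrite cnt D0; clear; lia.
- have tv := IH _ _ _ _ lDc (proper_swap12 rDc) vD; apply: traverses_sym.
  have [/in0 D0|/in0 D0|/in0 D0] := one pC.
  + by apply: traverses_eq (traverses_detour tv cb bxc) => w; rewrite cnt D0; clear; lia.
  + by apply: traverses_eq (traverses_detour tv cb axc) => w; rewrite cnt D0; clear; lia.
  + by rewrite D0 in vD.
Qed.

(** * Hamilton paths *)

Definition spanning a v := route a v (fun=> 1).

Lemma route_eq a v m m' : m =1 m' -> route a v m -> route a v m'.
Proof. by move=> mm' [p [pp l cn]]; exists p; split=> // w; rewrite cn mm'. Qed.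

Lemma route_hamilton a v : spanning a v -> exists p, hamilton_path e a v p.
Proof.
move=> [p [pp l cn]]; exists p; split=> //.
  apply: count_mem_uniq => w; rewrite cn; case: (boolP (w \in _)) => // /count_memPn.
  by rewrite cn.
by move=> w; rewrite -has_pred1 has_count cn.
Qed.

Lemma route_join a c b (D1 D2 : {set T}) : link a c D1 -> link c b D2 ->
  route a b (fun w => (a == w) + (b == w) + (c == w) + (w \in D1) + (w \in D2)).
Proof.
move=> [s1 p1 c1] [s2 p2 c2]; exists (s1 ++ c :: rcons s2 b); split.
- by rewrite rcons_path_cat p1.
- by rewrite last_cat /= last_rcons.
- by move=> w; rewrite /= !count_cat /= -cats1 count_cat c1 c2 /=; clear; lia.
Qed.

(** All three subregions may be nonempty here. Each case is a route with room for
all of them; for [v] equal to [x] it is [a b c x], with one on each edge. *)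
Lemma spanning_one_side a b c v C : region a b c C -> v != a ->
  (forall w, (a == w) + (b == w) + (c == w) + (w \in C) = 1) -> spanning a v.
Proof.
move=> rC va all1; case: (rC) => -[ab ac bc] _ _ _.
have cb : e c b by rewrite e_sym.
have vabc : [\/ b = v, c = v | v \in C].
  have := all1 v; rewrite eq_sym (negbTE va) /=.
  case: eqP => [->|_]; first by constructor.
  case: eqP => [->|_]; first by constructor 2.
  by case: (v \in C) => // _; constructor 3.
have [C0|C0] := eqVneq C set0.
  have l0 p q : e p q -> link p q set0.
    by move=> epq; exists [::] => [|z]; rewrite ?in_set0 //= epq.
  rewrite C0 in all1 vabc; case: vabc => [bv|cv|]; last by rewrite in_set0.
    subst v; apply: route_eq (route_join (l0 _ _ ac) (l0 _ _ cb)) => w.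
    by rewrite -(all1 w) in_set0; clear; lia.
  subst v; apply: route_eq (route_join (l0 _ _ ab) (l0 _ _ bc)) => w.
  by rewrite -(all1 w) in_set0; clear; lia.
have [x [Da [Db [Dc [[rDa rDb rDc] _ cnt _]]]]] := proper_split rC C0.
have [axb axc abc] := links_region rDa.
have [bxa bxc bac] := links_region rDb.
have [cxa cxb cab] := links_region rDc.
have [xb xc] : e x b /\ e x c by case: rDa => -[[]].
case: vabc => [bv|cv|vC].
- subst v; have cx : e c x by rewrite e_sym.
  apply: route_eq (traverses_absorb (traverses_join bac cx cxb) (link_sym axc)) => w.
  by rewrite -(all1 w) cnt; clear; lia.
- subst v; have bx : e b x by rewrite e_sym.
  apply: route_eq (traverses_absorb (traverses_join cab bx bxc) (link_sym axb)) => w.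
  by rewrite -(all1 w) cnt; clear; lia.
have : [\/ x = v, v \in Da, v \in Db | v \in Dc].
  have := cnt v; rewrite vC; case: eqP => [->|_]; first by constructor.
  by do 3?case: (v \in _); try by [constructor 2|constructor 3|constructor 4].
case=> [xv|vD|vD|vD].
- subst v.
  apply: route_eq (traverses_absorb (traverses_join cab bc (link_sym bxc)) abc) => w.
  by rewrite -(all1 w) cnt; clear; lia.
- have tv := traverses_prepend (traverses_region (proper_swap12 rDa) vD) cab.
  by apply: route_eq (traverses_absorb tv bxc) => w; rewrite -(all1 w) cnt; clear; lia.
- have tv := traverses_detour (traverses_region (proper_swap12 rDb) vD) bc cxb.
  by apply: route_eq (traverses_absorb tv abc) => w; rewrite -(all1 w) cnt; clear; lia.
- have tv := traverses_detour (traverses_region (proper_swap12 rDc) vD) cb bxc.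
  by apply: route_eq (traverses_absorb tv (link_sym abc)) => w; rewrite -(all1 w) cnt; clear; lia.
Qed.

Lemma spanning_two_sides a b c v C1 C2 :
  proper_region a b c C1 -> proper_region a b c C2 -> v != a ->
  (forall w, (a == w) + (b == w) + (c == w) + (w \in C1) + (w \in C2) = 1) ->
  spanning a v.
Proof.
move=> r1 r2 va all1.
have [ab1 ac1 bc1] := links_region r1.
have [ab2 ac2 bc2] := links_region r2.
have : [\/ b = v, c = v, v \in C1 | v \in C2].
  have := all1 v; rewrite eq_sym (negbTE va) /=.
  case: eqP => [->|_]; first by constructor.
  case: eqP => [->|_]; first by constructor 2.
  by do 2?case: (v \in _); try by [constructor 3|constructor 4].
case=> [bv|cv|vC|vC].
- subst v; apply: route_eq (route_join ac1 (link_sym bc2)) => w.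
  by rewrite -(all1 w); clear; lia.
- subst v; apply: route_eq (route_join ab1 bc2) => w.
  by rewrite -(all1 w); clear; lia.
- apply: route_eq (traverses_absorb (traverses_region r1 vC) bc2) => w.
  by rewrite -(all1 w); clear; lia.
- apply: route_eq (traverses_absorb (traverses_region r2 vC) bc1) => w.
  by rewrite -(all1 w); clear; lia.
Qed.

Lemma neighbour_exists (u v : T) : u != v -> exists w, e u w.
Proof.
move=> uv; case: (pickP (e u)) => [w uw|none]; first by exists w.
have s0 : sealed set0 [set u] by move=> y z; rewrite !inE => /eqP ->; rewrite none.
have := @sealed_pair set0 [set u] u v s0; rewrite !inE eqxx eq_sym cards0 => bad.
by have := bad isT isT uv isT.
Qed.

(** The rest of the graph is connected and both ends of the edge have neighbours
in it, since at most two vertices never separate; it thus contains a vertex adjacent to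
both ends. *)
Lemma triangle_exists u w v : e u w -> v != u -> v != w ->
  exists x, e u x /\ e w x.
Proof.
move=> uw vu vw; pose K := [set z in [:: u; w]]; pose C := ~: K.
have uNw : u != w by apply: contraTneq uw => ->; rewrite e_irr.
have wNu : w != u by rewrite eq_sym.
have vC : v \in C by rewrite !inE negb_or vu.
have nb p q : p != q -> {subset K <= [:: p; q]} -> {subset [:: p; q] <= K} ->
    exists2 x, x \in C & e p x.
  move=> pq Kpq pqK.
  case: (pickP [pred x | (x \in C) && e p x]) => [x /andP [xC px]|none]; first by exists x.
  have sp : sealed [set z in [:: q]] [set p].
    move=> y z; rewrite inE => /eqP -> epz; have := none z.
    rewrite /= epz andbT in_setC => /negbFE /Kpq; by rewrite !inE.
  have vK : v \notin [:: p; q] by apply: contraL vC => /pqK; rewrite in_setC => ->.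
  have vp : v \notin [set p] by rewrite inE; apply: contra vK => /eqP ->; apply: mem_head.
  have vq : v \notin [set z in [:: q]].
    by rewrite inE; apply: contra vK; rewrite !inE => ->; rewrite orbT.
  have pNq : p \notin [set z in [:: q]] by rewrite !inE.
  have := sealed_pair sp (set11 p) pNq vp vq.
  by move=> lt2; have := leq_trans lt2 (card_set_seq [:: q]).
have [x xC xK] : exists2 x, x \in C & {in K, forall k, e x k}.
  apply: chordal_dominating.
  - move=> k k'; rewrite !inE => /orP [] /eqP -> /orP [] /eqP ->; by rewrite ?eqxx // e_sym.
  - by rewrite disjoints_subset setCK.
  - by apply/set0Pn; exists v.
  - move=> y y' yC y'C; rewrite setCK; apply/negPn/negP => nyy'.
    rewrite in_setC in yC; rewrite in_setC in y'C.
    have := @tough_separated K [:: y; y']; rewrite /= yC y'C nyy' /= => /(_ isT isT isT).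
    by rewrite ltnNge card_set_seq.
  - move=> k; rewrite in_set !in_cons in_nil orbF => /orP [] /eqP ->.
      by apply: (nb u w) => // z; rewrite in_set.
    by apply: (nb w u) => // z; rewrite in_set !inE orbC.
by exists x; rewrite ![e _ x]e_sym !xK // !inE eqxx ?orbT.
Qed.

Lemma spanning_path u v : u != v -> spanning u v.
Proof.
move=> uv; have vu : v != u by rewrite eq_sym.
have [b ub] := neighbour_exists uv.
have irr p q : e p q -> (p == q) = false.
  by move=> epq; apply: contraTF epq => /eqP ->; rewrite e_irr.
have [small|[v' vv']] : (forall w, w \in [:: u; b]) \/ exists v', v' \notin [:: u; b].
  case: (pickP [pred w | w \notin [:: u; b]]) => [w wN|all]; first by right; exists w.
  by left=> w; have := all w; move/negbFE.
  have bv : b = v.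
    by have := small v; rewrite !inE (negbTE vu) => /eqP.
  subst v; exists [:: b]; rewrite /= ub; split=> // w; have := small w.
  rewrite !inE (eq_sym w) (eq_sym w) /=.
  by case: eqP => [<-|_]; rewrite ?(eq_sym b) ?(irr u b) //= => ->.
have [v'u v'b] : v' != u /\ v' != b.
  by apply/andP; move: vv'; rewrite !inE negb_or.
have [c [uc bc]] := triangle_exists ub v'u v'b.
pose K := [set z in [:: u; b; c]].
have K3 : #|K| <= 3 := card_set_seq _.
have abcK w : (u == w) + (b == w) + (c == w) = (w \in K).
  rewrite in_set !in_cons in_nil orbF !(eq_sym w).
  have [<-|_] := eqVneq u w; first by rewrite (irr b u) ?(irr c u) // e_sym.
  have [<-|_] := eqVneq b w; first by rewrite (irr c b) // e_sym.
  by case: (c == w).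
have mkregion (D : {set T}) : [disjoint D & K] -> sealed K D ->
    {in D &, forall y y', conn (~: D) y y'} -> region u b c D.
  move=> DK sD cD; split=> //.
  by split; apply/negP => /(disjointFr DK); rewrite !inE eqxx ?orbT.
case: (pickP [pred y | y \notin K]) => [y1 /= y1K|all]; last first.
  apply: (@spanning_one_side u b c v set0) => //.
    apply: mkregion.
    - by rewrite disjoints_subset sub0set.
    - by move=> y z; rewrite inE.
    - by move=> y z; rewrite inE.
  by move=> w; rewrite abcK in_set0; have /negbFE -> := all w.
(* [C1] is the component of [y1]; the rest is connected because a third component
   would contradict toughness. *)
pose C1 := [set z | conn K y1 z]; pose C2 := ~: (K :|: C1).
have y1C1 : y1 \in C1 by rewrite inE connect0.
have s1 : sealed K C1 by apply: sealed_component y1K _ => z k.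
have C1K : [disjoint C1 & K].
  rewrite disjoints_subset; apply/subsetP => z; rewrite inE => yz.
  have sC : sealed K (~: K) by move=> *; rewrite in_setU in_setC orNb.
  have y1C : y1 \in ~: K by rewrite in_setC.
  by case/andP: (sealed_conn sC y1C yz).
have r1 : region u b c C1.
  apply: mkregion => // y y' yC y'C.
  have yy' : conn K y y'.
    by rewrite !inE in yC y'C; apply: connect_trans y'C; rewrite conn_sym.
  by case/andP: (sealed_conn s1 yC yy').
have [C20|C2n] := eqVneq C2 set0.
  apply: (spanning_one_side r1 vu) => w; rewrite abcK.
  have := in_set0 w; rewrite -C20 in_setC in_setU => /negbFE.
  by case: (boolP (w \in C1)) => [wC|_]; rewrite ?(disjointFr C1K wC) // orbF => ->.
have C2K : [disjoint C2 & K].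
  by rewrite disjoints_subset setCS subsetUl.
have C12 : [disjoint C1 & C2].
  by rewrite disjoint_sym disjoints_subset setCS subsetUr.
have s2 : sealed K C2.
  move=> y z yC2 eyz; have [yK yC1] : y \notin K /\ y \notin C1.
    by apply/andP; rewrite -negb_or -in_setU -in_setC.
  rewrite in_setU in_setC in_setU; case: (boolP (z \in K)) => //= zK.
  rewrite orbF; apply: contra yC1; rewrite !inE => zC1.
  by apply: connect_trans zC1 (connect1 _); rewrite /del_rel /= zK yK e_sym.
have r2 : region u b c C2.
  apply: mkregion => // y y' yC y'C.
  by apply: (sealed_connected K3 s2 C2K _ y1K) => //; rewrite (disjointFr C12 y1C1).
have [y2 y2C2] := set0Pn _ C2n.
apply: (@spanning_two_sides u b c v C1 C2) => //.
- split=> //; exists y2; first by rewrite (disjointFl C12 y2C2).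
  by have := disjointFr C2K y2C2; rewrite in_set => ->.
- split=> //; exists y1; first by rewrite (disjointFr C12 y1C1).
  by move: y1K; rewrite in_set.
move=> w; rewrite abcK in_setC in_setU.
by case: (boolP (w \in K)) => [wK|_]; rewrite ?(disjointFl C1K wK) //=; case: (w \in C1).
Qed.

End Graph.

Theorem mainTheorem4 (R : realType) (T : finType) (e : rel T)
  (e_sym : symmetric e) (e_irr : irreflexive e)
  (e_chordal : chordal e) (e_planar : planar R e)
  (e_tough : (1%:E < toughness e)%E) :
  hamilton_connected e.
Proof.
move=> u v uv; apply: route_hamilton; apply: spanning_path => //.
by move=> s; apply: planar_K5_free e_irr e_planar.
Qed.
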